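(* Let $S$ be a set. There is a bijection between KZ-systems on $S$ and pre-Dynkin systems on $S_+=S\cup\{0\}$, \[\Phi\colon KZ(S)\to \mathrm{Dynk}^{pre}(S_+),\qquad \Phi(X)=X\cup X^\perp_+,\] where $X^\perp_+=\{S_+\setminus A : A\in X\}$. The inverse function is given by $\Psi(Y)=\{A\in Y : 0\notin A\}$.
   Context: Here $0$ is an element not in $S$, and $\mathcal{P}(T)$ denotes the power set of a set $T$. A family $X\subseteq\mathcal{P}(S)$ is a KZ-system on $S$ if: (1) $\varnothing\in X$; (2) for any $A,B\in X$ with $A\cap B=\varnothing$ one has $A\cup B\in X$; (3) if $A\in X$, $B\subseteq S$ with $B\notin X$, and $A\cap B=\varnothing$, then $A\cup B\notin X$. $KZ(S)$ is the set of KZ-systems on $S$. A family $X\subseteq\mathcal{P}(T)$ is a pre-Dynkin system on a set $T$ if: (a) $\varnothing\in X$; (b) $A\in X$ implies $T\setminus A\in X$; (c) if $A,B\in X$ and $A\cap B=\varnothing$ then $A\cup B\in X$. $\mathrm{Dynk}^{pre}(T)$ is the set of pre-Dynkin systems on $T$. *)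

(* Defs.v *)
From mathcomp Require Import all_boot.
From mathcomp Require Import boolp classical_sets functions.

Set Implicit Arguments.
Unset Strict Implicit.
Unset Printing Implicit Defensive.

Local Open Scope classical_set_scope.

(* Base sets are sets [S : set U] in an ambient type [U], and the families of
   subsets of [S] are the [X : set (set U)] all of whose members are included
   in [S]; complements are relative to the base set. *)

Definition is_KZ_system (U : Type) (S : set U) (X : set (set U)) : Prop :=
  [/\ X `<=` [set A | A `<=` S],
      X set0,
      forall A B, X A -> X B -> A `&` B = set0 -> X (A `|` B)
    & forall A B, X A -> B `<=` S -> ~ X B -> A `&` B = set0 ->
        ~ X (A `|` B)].

Definition is_pre_dynkin (U : Type) (T : set U) (X : set (set U)) : Prop :=
  [/\ X `<=` [set A | A `<=` T],
      X set0,
      forall A, X A -> X (T `\` A)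
    & forall A B, X A -> X B -> A `&` B = set0 -> X (A `|` B)].

Definition KZ (U : Type) (S : set U) : set (set (set U)) :=
  [set X | is_KZ_system S X].

Definition pre_Dynk (U : Type) (T : set U) : set (set (set U)) :=
  [set X | is_pre_dynkin T X].

(* In what follows [o : U] plays the role of the element 0 not in [S]. *)

Definition adjoin (U : Type) (S : set U) (o : U) : set U := S `|` [set o].

Definition perp_plus (U : Type) (S : set U) (o : U) (X : set (set U)) :
  set (set U) := [set adjoin S o `\` A | A in X].

Definition Phi (U : Type) (S : set U) (o : U) (X : set (set U)) :
  set (set U) := X `|` perp_plus S o X.

Definition Psi (U : Type) (o : U) (Y : set (set U)) : set (set U) :=
  [set A | Y A /\ ~ A o].

(* Main.v *)
Require Import Defs.
From mathcomp Require Import all_boot.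
From mathcomp Require Import boolp classical_sets functions.

Local Open Scope classical_set_scope.

(** Write [T] for [adjoin S o]. Complementation in [T] exchanges the subsets of
    [T] that avoid [o], i.e. the subsets of [S], with those that contain [o]. A
    family on [T] stable under complement is therefore determined by its
    members that avoid [o], and any family on [S] is the [o]-avoiding part of
    its closure under complement; this gives the two cancellation identities
    [Phi_setK] and [Psi_setK].

    What remains is that the axioms correspond, and the link is stability under
    proper difference: [B `\` A] is in the family as soon as [A `<=` B] are. The
    third axiom of KZ-systems is the contrapositive of this stability
    ([KZ_setD]), while pre-Dynkin systems have
    it because [B `\` A] is the complement of the disjoint union of [A] and the
    complement of [B] ([pre_Dynk_setD]). In the other direction, the union of
    [A] and a disjoint complement [T `\` B] is the complement of the proper
    difference [B `\` A], and two complements are never disjoint since both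
    contain [o]; so stability under proper difference is what makes [Phi S o X]
    stable under disjoint union. *)

Section ProperDifference.
Context {U : Type}.
Implicit Types (S T A B : set U) (X Y : set (set U)).

Lemma subset_setDD T A : A `<=` T -> T `\` (T `\` A) = A.
Proof. by move=> AT; rewrite setDD setIC; exact/setIidPl. Qed.

(** Otherwise the third axiom would exclude [B], the union of [A] and
    [B `\` A]. *)
Lemma KZ_setD S X A B :
  KZ S X -> X A -> X B -> A `<=` B -> X (B `\` A).
Proof.
case=> XS _ _ X3 XA XB AB; apply: contrapT => XBA.
have BAS : B `\` A `<=` S by move=> x [Bx _]; exact: XS Bx.
by apply: X3 XA BAS XBA _ _; rewrite ?setDIK ?setDUK.
Qed.

(** A proper difference is a complement of a disjoint union: [A `<=` B] makes
    [A] disjoint from the complement of [B]. *)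
Lemma pre_Dynk_setD T Y A B :
  pre_Dynk T Y -> Y A -> Y B -> A `<=` B -> Y (B `\` A).
Proof.
case=> YT _ YC YU YA YB AB.
have BT := YT _ YB.
have -> : B `\` A = T `\` (A `|` (T `\` B)).
  rewrite setDUr subset_setDD // setIDAC setIidr //.
  exact: subset_trans (@subDsetl _ B A) BT.
apply/YC/YU => //; first exact: YC.
by apply/disjoints_subset => x /AB Bx [].
Qed.

End ProperDifference.

Section Adjoin.
Context {U : Type} {S : set U} {o : U}.
Hypothesis oS : ~ S o.
Implicit Types (A B : set U) (X Y : set (set U)).
Let T := adjoin S o.

Lemma sub_adjoin : S `<=` T.
Proof. exact: subsetUl. Qed.

Lemma sub_adjoin_notin A : A `<=` T -> ~ A o -> A `<=` S.
Proof. by move=> AT Ao x Ax; case: (AT x Ax) => // xo; rewrite xo in Ax. Qed.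

Lemma compl_adjoin_mem A : A `<=` S -> (T `\` A) o.
Proof. by move=> AS; split; [right|move/AS]. Qed.

Lemma Phi_pre_Dynk X : KZ S X -> pre_Dynk T (Phi S o X).
Proof.
move=> KX; have [XS X0 XU _] := KX.
have XT A : X A -> A `<=` T by move=> /XS /subset_trans; apply; exact: sub_adjoin.
(* the only unions that the axioms do not cover directly: one set avoids [o]
   and the other contains it *)
have mixed A B : X A -> X B -> A `&` (T `\` B) = set0 ->
    Phi S o X (A `|` (T `\` B)).
  move=> XA XB AB0.
  have AB : A `<=` B.
    move=> x Ax; apply: contrapT => Bx.
    by have : set0 x by rewrite -AB0; split=> //; split=> //; exact: XT Ax.
  right; exists (B `\` A); first exact: KZ_setD KX XA XB AB.
  by rewrite -/T setDDr (setIidr (XT _ XA)) setUC.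
split.
- by move=> _ [/XT //|[A _ <-]]; exact: subDsetl.
- by left.
- move=> A [XA|[A' XA <-]]; first by right; exists A.
  by left; rewrite -/T subset_setDD //; exact: XT.
- move=> A B [XA|[A' XA <-]] [XB|[B' XB <-]] AB0.
  + by left; exact: XU.
  + exact: mixed.
  + by rewrite setUC; apply: mixed => //; rewrite setIC.
  + have : set0 o by rewrite -AB0; split; apply: compl_adjoin_mem; exact: XS.
    by [].
Qed.

Lemma Psi_KZ Y : pre_Dynk T Y -> KZ S (Psi o Y).
Proof.
move=> DY; have [YT Y0 _ YU] := DY; split.
- by move=> A [/YT AT Ao]; exact: sub_adjoin_notin AT Ao.
- by split.
- by move=> A B [YA Ao] [YB Bo] AB0; split; [exact: YU|case].
- move=> A B [YA Ao] BS nYB AB0 [YAB _]; apply: nYB; split; last by move/BS.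
  (* stability under proper difference, contradicting that [B] is not in [Y] *)
  have -> : B = (A `|` B) `\` A.
    by rewrite setDUl setDv set0U; apply/esym/setDidPl; rewrite setIC.
  by apply: pre_Dynk_setD DY YA YAB _; exact: subsetUl.
Qed.

Lemma Phi_setK X : KZ S X -> Psi o (Phi S o X) = X.
Proof.
case=> XS _ _ _; apply/seteqP; split=> [A [[//|[B /XS BS <-]]]|A XA].
  by case; exact: compl_adjoin_mem.
by split; [left|move/(XS _ XA)].
Qed.

Lemma Psi_setK Y : pre_Dynk T Y -> Phi S o (Psi o Y) = Y.
Proof.
case=> YT _ YC _; apply/seteqP; split=> [_ [[]//|[A [YA _] <-]]|A YA].
  exact: YC.
have [Ao|Ao] := pselect (A o); last by left.
right; exists (T `\` A); last exact: subset_setDD (YT _ YA).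
by split; [exact: YC|case].
Qed.

End Adjoin.

Theorem theorem4p3 (U : Type) (S : set U) (o : U) (oS : ~ S o) :
  [/\ set_bij (KZ S) (pre_Dynk (adjoin S o)) (Phi S o),
      set_fun (pre_Dynk (adjoin S o)) (KZ S) (Psi o),
      forall X, KZ S X -> Psi o (Phi S o X) = X
    & forall Y, pre_Dynk (adjoin S o) Y -> Phi S o (Psi o Y) = Y].
Proof.
split; [split| |exact: Phi_setK|exact: Psi_setK].
- exact: Phi_pre_Dynk.
- move=> X X' /set_mem KX /set_mem KX' XX'.
  by rewrite -(Phi_setK oS X KX) XX' Phi_setK.
- move=> Y DY; exists (Psi o Y); [exact: Psi_KZ|exact: Psi_setK].
- exact: Psi_KZ.
Qed.
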